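(* Let $\mathcal{X}_c$ be an invariant subspace of dimension $p$ of a matrix $A\in\mathbb{S}\subset\mathbb{K}^{n\times n}$, and let $X_c\in\mathbb{K}^{n\times p}$ be a full rank matrix with $AX_c=X_c\Lambda_c$, $\mathfrak{R}(X_c)=\mathcal{X}_c$, $\Lambda_c\in\mathbb{K}^{p\times p}$. Let $\Lambda_a\in\mathbb{K}^{p\times p}$ be such that $X_c^\star HX_c\Lambda_a=\epsilon_1\epsilon_2(X_c^\star HX_c\Lambda_a)^\star$. Let $\mathcal{X}_f$ be an invariant subspace of $A$ complementary to $\mathcal{X}_c$, and suppose there exist $X_f\in\mathbb{K}^{n\times(n-p)}$ with $\mathfrak{R}(X_f)=\mathcal{X}_f$ and $\Lambda_f\in\mathbb{K}^{(n-p)\times(n-p)}$ such that $AX_f=X_f\Lambda_f$ and $\sigma(\epsilon_2\Lambda_c^\star)\cap\sigma(\Lambda_f)=\emptyset$. (i) Put $X=\begin{bmatrix}X_c & X_f\end{bmatrix}$ and $B=\begin{bmatrix}X_c\Lambda_a-AX_c & 0\end{bmatrix}$. Then the matrix $$\Delta A=BX^{-1}+\epsilon_1\epsilon_2H^{-1}\left[(HBX^{-1})^\star-(X^{-1})^\star(X^\star HB)^\star X^{-1}\right]$$ belongs to $\mathbb{S}$ and $\mathcal{X}_c,\mathcal{X}_f$ are complementary invariant subspaces of $A+\Delta A$, with $$(A+\Delta A)\begin{bmatrix}X_c & X_f\end{bmatrix}=\begin{bmatrix}X_c & X_f\end{bmatrix}\begin{bmatrix}\Lambda_a & 0\\ 0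 & \Lambda_f\end{bmatrix}.$$ (ii) A perturbation that does not require knowledge of $X_f$ and $\Lambda_f$ (only their existence) is the following: the inverse below exists, and the matrix $$\Delta A=X_c(\Lambda_a-\Lambda_c)(X_c^\star HX_c)^{-1}X_c^\star H$$ belongs to $\mathbb{S}$, has rank at most $p$, and satisfies $(A+\Delta A)X_c=X_c\Lambda_a$ and $(A+\Delta A)X_f=X_f\Lambda_f$; thus the complementary invariant subspaces $\mathcal{X}_c$ and $\mathcal{X}_f$ of $A$ remain invariant for $A+\Delta A\in\mathbb{S}$.
   Context: $\mathbb{K}\in\{\mathbb{R},\mathbb{C}\}$ and $\star\in\{T,*\}$ (transpose or conjugate transpose). $H\in\mathbb{K}^{n\times n}$ is a fixed unitary matrix with $H^\star=\epsilon_1H$, $\epsilon_1\in\{1,-1\}$. For $A\in\mathbb{K}^{n\times n}$ put $A^{[\star]}=H^{-1}A^\star H$. Let $\mathbb{L}=\{A\in\mathbb{K}^{n\times n}:A^{[\star]}=-A\}$ (Lie algebra) and $\mathbb{J}=\{A\in\mathbb{K}^{n\times n}:A^{[\star]}=A\}$ (Jordan algebra). $\mathbb{S}\in\{\mathbb{L},\mathbb{J}\}$, with $\epsilon_2=1$ if $\mathbb{S}=\mathbb{J}$ and $\epsilon_2=-1$ if $\mathbb{S}=\mathbb{L}$. $\sigma(M)$ is the spectrum (set of complex eigenvalues) of $M$ and $\mathfrak{R}(X)$ is the column space of $X$. Two invariant subspaces are complementary if their direct sum is $\mathbb{K}^n$. *)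

(* Defs.v *)
From mathcomp Require Import all_boot all_order all_algebra.
From mathcomp Require Import classical_sets reals.
From mathcomp.real_closed Require Import complex.

Set Implicit Arguments.
Unset Strict Implicit.
Unset Printing Implicit Defensive.

Import GRing.Theory Num.Theory.

Local Open Scope ring_scope.

Inductive base_field := RealNumbers | ComplexNumbers.
Inductive star_kind := Transpose | ConjTranspose.
Inductive algebra_kind := LieAlgebra | JordanAlgebra.

Definition Kfield (R : realType) (k : base_field) : fieldType :=
  match k with
  | RealNumbers => R : fieldType
  | ComplexNumbers => R[i] : fieldType
  end.

Definition conj_scalar (R : realType) (k : base_field) :
    Kfield R k -> Kfield R k :=
  match k with
  | RealNumbers => fun x : R => x
  | ComplexNumbers => fun z : R[i] => conjc z
  end.

Definition to_complex (R : realType) (k : base_field) : Kfield R k -> R[i] :=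
  match k with
  | RealNumbers => fun x : R => (x%:C)%C
  | ComplexNumbers => fun z : R[i] => z
  end.

Arguments conj_scalar {R} k _.
Arguments to_complex {R} k _.

Section Matrices.
Variables (R : realType) (k : base_field).
Local Notation K := (Kfield R k).

Definition conj_transpose (m n : nat) (M : 'M[K]_(m, n)) : 'M[K]_(n, m) :=
  map_mx (conj_scalar k) M^T.

Definition unitary_mx (n : nat) (M : 'M[K]_n) : Prop :=
  conj_transpose M *m M = 1%:M.

Definition star_mx (s : star_kind) (m n : nat) (M : 'M[K]_(m, n)) :
    'M[K]_(n, m) :=
  match s with
  | Transpose => M^T
  | ConjTranspose => conj_transpose M
  end.

Definition star_adjoint (s : star_kind) (n : nat) (H A : 'M[K]_n) : 'M[K]_n :=
  invmx H *m star_mx s A *m H.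

Definition in_algebra (s : star_kind) (n : nat) (H : 'M[K]_n)
    (a : algebra_kind) (A : 'M[K]_n) : Prop :=
  match a with
  | LieAlgebra => star_adjoint s H A = - A
  | JordanAlgebra => star_adjoint s H A = A
  end.

Definition eps2 (a : algebra_kind) : K :=
  match a with
  | LieAlgebra => -1
  | JordanAlgebra => 1
  end.

(* A real matrix is viewed over R[i], so that its non-real eigenvalues are
   counted. The eigenvectors in [eigenvalue] are row vectors; for a square
   matrix over a field the eigenvalues are the same as with column vectors. *)
Definition spectrum (n : nat) (M : 'M[K]_n) : set R[i] :=
  [set z | eigenvalue (map_mx (to_complex k) M) z]%classic.

Definition colspace (m n : nat) (M : 'M[K]_(m, n)) : {vspace 'cV[K]_m} :=
  limg (linfun (mulmx M : 'cV[K]_n -> 'cV[K]_m)).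

Definition invariant_subspace (n : nat) (A : 'M[K]_n)
    (U : {vspace 'cV[K]_n}) : Prop :=
  forall v : 'cV[K]_n, v \in U -> A *m v \in U.

Definition complementary_subspaces (n : nat) (U V : {vspace 'cV[K]_n}) : Prop :=
  directv (U + V) /\ (U + V)%VS = fullv.

(* The matrix [U V] as a square matrix, since row_mx U V has p + (n - p)
   columns, which is n only up to a propositional equality. *)
Definition hcat (n p : nat) (hp : (p <= n)%N)
    (U : 'M[K]_(n, p)) (V : 'M[K]_(n, n - p)) : 'M[K]_n :=
  castmx (erefl n, subnKC hp) (row_mx U V).

End Matrices.

Arguments eps2 {R k} a.

(* Main.v *)
(** Write [M^s] for the star of [M]. Membership of [A] in the algebra means
    [(H A)^s = eps1 eps2 (H A)], hence [Y = Xc^s H Xf] solves the homogeneous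
    Sylvester equation [(eps2 Lc^s) Y = Y Lf] and vanishes because the spectra
    are disjoint. As [X = [Xc Xf]] and [H] are invertible, [G = Xc^s H Xc] is
    then invertible as well. In (i) the bracket cancels, so the perturbation is
    just [B X^-1]; it agrees with the perturbation of (ii) on the columns of
    [X], so the two coincide. *)

Require Import Defs.
From mathcomp Require Import all_boot all_order all_algebra.
From mathcomp Require Import classical_sets reals.
From mathcomp.real_closed Require Import complex.

Import GRing.Theory Num.Theory.

Local Open Scope ring_scope.

(** * Homogeneous Sylvester equations *)

Lemma horner_mx_intertwine {F : fieldType} {m n : nat} {A : 'M[F]_m.+1}
    {B : 'M[F]_n.+1} {Y : 'M[F]_(m.+1, n.+1)} (q : {poly F}) :
  A *m Y = Y *m B -> horner_mx A q *m Y = Y *m horner_mx B q.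
Proof.
move=> AY; elim/poly_ind: q => [|q c IHq]; first by rewrite !rmorph0 mul0mx mulmx0.
rewrite !rmorphD !rmorphM /= !horner_mx_X !horner_mx_C mulmxDl mulmxDr.
by rewrite -!mulmxE -mulmxA AY mulmxA IHq !mulmxA mul_scalar_mx mul_mx_scalar.
Qed.

(** With [q = char_poly A], Cayley-Hamilton and intertwining give [Y *m q(B) = 0]. Over a closed
    field [q(B)] is a product of factors [B - z] with [z] an eigenvalue of [A]; each is invertible
    since [z] is not an eigenvalue of [B]. *)
Lemma sylvester_eq0 {F : closedFieldType} {m n : nat} {A : 'M[F]_m}
    {B : 'M[F]_n} {Y : 'M[F]_(m, n)} :
  (forall z, ~ (eigenvalue A z /\ eigenvalue B z)) -> A *m Y = Y *m B -> Y = 0.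
Proof.
case: m n A B Y => [|m] [|n] A B Y disj AY;
  (* [horner_mx] needs positive sizes; if [m] or [n] is 0, [Y] has no entries. *)
  try (by apply/matrixP=> -[]); try (by apply/matrixP=> i []).
have [r char_A] := closed_field_poly_normal (char_poly A).
move: char_A; rewrite (monicP (char_poly_monic A)) scale1r => char_A.
have unitB : horner_mx B (char_poly A) \in unitmx.
  rewrite char_A rmorph_prod /= big_seq_cond.
  apply: (big_ind (fun M : 'M_n.+1 => M \in unitmx)) => [|M N uM uN|z].
  - exact: unitmx1.
  - by rewrite -mulmxE unitmx_mul uM.
  rewrite andbT => zr; rewrite rmorphB /= horner_mx_X horner_mx_C.
  have Az : eigenvalue A z by rewrite eigenvalue_root_char char_A root_prod_XsubC.
  rewrite -row_free_unit -kermx_eq0; apply: contraT => Bz.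
  by case: (disj z).
have := horner_mx_intertwine (char_poly A) AY.
rewrite Cayley_Hamilton mul0mx => /esym Y0.
by rewrite -(mulmxK unitB Y) Y0 mul0mx.
Qed.

(** * The star operation, the two algebras, and spectra over the base field *)

Section Star.
Context {R : realType} {k : base_field}.
Local Notation K := (Kfield R k).
Implicit Types s : star_kind.

Lemma star_mxM s m n l (M : 'M[K]_(m, n)) (N : 'M[K]_(n, l)) :
  star_mx s (M *m N) = star_mx s N *m star_mx s M.
Proof.
case: s; first exact: trmx_mul.
rewrite /= /conj_transpose trmx_mul; case: k M N => M N /=; last exact: map_mxM.
by rewrite !map_mx_id.
Qed.

Lemma star_mxK s m n (M : 'M[K]_(m, n)) : star_mx s (star_mx s M) = M.
Proof.
case: s; first exact: trmxK.
rewrite /= /conj_transpose; case: k M => M; apply/matrixP=> i j; rewrite !mxE //=.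
exact: conjcK.
Qed.

Lemma star_mxD s m n (M N : 'M[K]_(m, n)) :
  star_mx s (M + N) = star_mx s M + star_mx s N.
Proof.
case: s; first exact: raddfD.
rewrite /= /conj_transpose; case: k M N => M N; apply/matrixP=> i j; rewrite !mxE //=.
exact: rmorphD.
Qed.

Lemma star_mx0 s m n : star_mx s (0 : 'M[K]_(m, n)) = 0.
Proof. by apply: (addIr (star_mx s 0)); rewrite -star_mxD !add0r. Qed.

Lemma star_mxN s m n (M : 'M[K]_(m, n)) : star_mx s (- M) = - star_mx s M.
Proof. by apply: (addIr (star_mx s M)); rewrite -star_mxD !addNr star_mx0. Qed.

(** Uniform in both stars, from the involution and product laws alone:
    [1^s = (1^s)^s 1^s = (1 1^s)^s = 1]. *)
Lemma star_mx1 s n : star_mx s (1%:M : 'M[K]_n) = 1%:M.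
Proof. by rewrite -[LHS]mul1mx -{1}[1%:M](star_mxK s) -star_mxM mul1mx star_mxK. Qed.

Lemma star_unitmx s n (M : 'M[K]_n) : M \in unitmx -> star_mx s M \in unitmx.
Proof.
by move=> uM; case: (mulmx1_unit (_ : star_mx s M *m star_mx s (invmx M) = 1%:M));
  rewrite // -star_mxM mulVmx ?star_mx1.
Qed.

Lemma star_invmx s n (M : 'M[K]_n) :
  M \in unitmx -> star_mx s (invmx M) = invmx (star_mx s M).
Proof.
move=> uM; have usM := star_unitmx s _ _ uM.
by rewrite -[LHS](mulKmx usM) -star_mxM mulVmx // star_mx1 mulmx1.
Qed.

Lemma unitary_unitmx n (H : 'M[K]_n) : unitary_mx H -> H \in unitmx.
Proof. by case/mulmx1_unit. Qed.

Lemma eps2_sign alg : eps2 alg = 1 :> K \/ eps2 alg = -1 :> K.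
Proof. by case: alg; [right | left]. Qed.

(** Both algebras become one symmetry condition on [H *m M], which congruences preserve. It holds
    because [(H M)^s = eps1 M^s H] and the sign [eps1] cancels. *)
Lemma in_algebraP s n (H : 'M[K]_n) (eps1 : K) alg (M : 'M[K]_n) :
  H \in unitmx -> eps1 = 1 \/ eps1 = -1 -> star_mx s H = eps1 *: H ->
  in_algebra s H alg M <-> star_mx s (H *m M) = (eps1 * eps2 alg) *: (H *m M).
Proof.
move=> uH heps1 Hs.
have -> : in_algebra s H alg M <-> star_adjoint s H M = eps2 alg *: M.
  by case: alg; rewrite /= ?scaleN1r ?scale1r.
rewrite star_mxM Hs -scalemxAr -scalerA /star_adjoint -mulmxA; split=> [MH|].
  by rewrite (scalemxAr (eps2 alg)) -MH mulKVmx.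
have e1 : eps1 != 0 by case: heps1 => ->; rewrite ?oppr_eq0 oner_eq0.
by move/(scalerI e1)=> ->; rewrite -scalemxAr mulKmx.
Qed.

Lemma in_algebraD s n (H : 'M[K]_n) alg (M N : 'M[K]_n) :
  in_algebra s H alg M -> in_algebra s H alg N -> in_algebra s H alg (M + N).
Proof.
case: alg; rewrite /= /star_adjoint star_mxD mulmxDr mulmxDl => -> -> //.
by rewrite opprD.
Qed.

(** Real matrices are embedded in [R[i]], which is algebraically closed; the embedding is injective,
    so [Y = 0] descends to [R]. *)
Lemma spectrum_sylvester_eq0 m n (L : 'M[K]_m) (M : 'M[K]_n) (Y : 'M[K]_(m, n)) :
  (spectrum L `&` spectrum M = set0)%classic -> L *m Y = Y *m M -> Y = 0.
Proof.
rewrite /spectrum; case: k L M Y => L M Y /= disj LY.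
- have disj' z : ~ (eigenvalue (map_mx (@real_complex R) L) z /\
                    eigenvalue (map_mx (@real_complex R) M) z).
    by move=> Lz; suff: (set0 : set R[i]) z by []; rewrite -disj.
  have := congr1 (map_mx (@real_complex R)) LY; rewrite !map_mxM.
  by move/(sylvester_eq0 disj')/eqP; rewrite map_mx_eq0 => /eqP.
- have disj' z : ~ (eigenvalue L z /\ eigenvalue M z).
    move=> Lz; suff: (set0 : set R[i]) z by [].
    by rewrite -disj /= !map_mx_id.
  exact: (sylvester_eq0 disj' LY).
Qed.

(** * Column spaces and the matrix [[U V]] *)

Lemma mem_colspace m n (M : 'M[K]_(m, n)) (v : 'cV[K]_m) :
  v \in colspace M <-> exists u, v = M *m u.
Proof.
split=> [/memv_imgP[u _ ->]|[u ->]]; first by exists u; rewrite lfunE.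
by apply/memv_imgP; exists u; rewrite ?memvf // lfunE.
Qed.

Lemma colspace_invariant n l (A : 'M[K]_n) (U : 'M[K]_(n, l)) (L : 'M[K]_l) :
  A *m U = U *m L -> invariant_subspace A (colspace U).
Proof.
move=> AU v /mem_colspace[u ->]; apply/mem_colspace; exists (L *m u).
by rewrite !mulmxA AU.
Qed.

Lemma mul_hcat n p (hp : (p <= n)%N) (M : 'M[K]_n) (U : 'M[K]_(n, p))
    (V : 'M[K]_(n, n - p)) :
  M *m hcat hp U V = hcat hp (M *m U) (M *m V).
Proof.
rewrite /hcat -mul_mx_row.
(* Stated for an arbitrary equality [q = l], so that case analysis on it erases the cast. *)
have cast_mul l q (e : q = l) (N : 'M[K]_(n, q)) :
  M *m castmx (erefl n, e) N = castmx (erefl n, e) (M *m N) by case: l / e.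
exact: cast_mul.
Qed.

(** Each standard basis vector splits as [U u + V v], the product of [[U V]] with the stacked column
    of [u] and [v]. *)
Lemma row_mx_right_inverse n p q (U : 'M[K]_(n, p)) (V : 'M[K]_(n, q)) :
  (colspace U + colspace V)%VS = fullv -> exists W, row_mx U V *m W = 1%:M.
Proof.
move=> UV; suff /row_fullP[W WUV] : row_full (row_mx U V)^T.
  by exists W^T; apply: (can_inj trmxK); rewrite trmx_mul trmxK trmx1.
rewrite -sub1mx; apply/row_subP=> j.
have : (row j 1%:M)^T \in (colspace U + colspace V)%VS by rewrite UV memvf.
case/memv_addP=> _ /mem_colspace[u ->] [_ /mem_colspace[v ->] def_j].
by rewrite -[row j _]trmxK def_j -mul_row_col trmx_mul submxMl.
Qed.

Lemma hcat_unitmx n p (hp : (p <= n)%N) (U : 'M[K]_(n, p)) (V : 'M[K]_(n, n - p)) :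
  (colspace U + colspace V)%VS = fullv -> hcat hp U V \in unitmx.
Proof.
case/row_mx_right_inverse=> W UVW.
have cast_mul l q (e : q = l) (M : 'M[K]_(n, q)) N :
  castmx (erefl n, e) M *m castmx (e, erefl n) N = M *m N by case: l / e.
by case: (mulmx1_unit (etrans (cast_mul _ _ (subnKC hp) _ _) UVW)).
Qed.

End Star.

Theorem theorem2p7 (R : realType) (k : base_field) (s : star_kind)
    (n p : nat) (hp : (p <= n)%N)
    (H : 'M[Kfield R k]_n) (eps1 : Kfield R k)
    (heps1 : eps1 = 1 \/ eps1 = -1)
    (H_unitary : unitary_mx H) (H_star : star_mx s H = eps1 *: H)
    (alg : algebra_kind) (A : 'M[Kfield R k]_n) (hA : in_algebra s H alg A)
    (VXc : {vspace 'cV[Kfield R k]_n})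
    (VXc_inv : invariant_subspace A VXc) (VXc_dim : \dim VXc = p)
    (Xc : 'M[Kfield R k]_(n, p)) (Lc : 'M[Kfield R k]_p)
    (Xc_rank : \rank Xc = p) (Xc_eq : A *m Xc = Xc *m Lc)
    (Xc_span : colspace Xc = VXc)
    (La : 'M[Kfield R k]_p)
    (hLa : star_mx s Xc *m H *m Xc *m La
           = (eps1 * eps2 alg) *: star_mx s (star_mx s Xc *m H *m Xc *m La))
    (VXf : {vspace 'cV[Kfield R k]_n})
    (VXf_inv : invariant_subspace A VXf) (VXcf : complementary_subspaces VXc VXf)
    (Xf : 'M[Kfield R k]_(n, n - p)) (Lf : 'M[Kfield R k]_(n - p))
    (Xf_span : colspace Xf = VXf) (Xf_eq : A *m Xf = Xf *m Lf)
    (hspec : (spectrum (eps2 alg *: star_mx s Lc) `&` spectrum Lf = set0)%classic) :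
  (let X := hcat hp Xc Xf in
   let B := hcat hp (Xc *m La - A *m Xc) 0 in
   let DA := B *m invmx X
     + (eps1 * eps2 alg) *:
         (invmx H *m (star_mx s (H *m B *m invmx X)
                      - star_mx s (invmx X) *m star_mx s (star_mx s X *m H *m B)
                        *m invmx X)) in
   [/\ X \in unitmx,
       in_algebra s H alg DA,
       [/\ invariant_subspace (A + DA) VXc, invariant_subspace (A + DA) VXf
         & complementary_subspaces VXc VXf]
     & (A + DA) *m row_mx Xc Xf = row_mx Xc Xf *m block_mx La 0 0 Lf])
  /\
  (let G := star_mx s Xc *m H *m Xc in
   let DA := Xc *m (La - Lc) *m invmx G *m star_mx s Xc *m H in
   G \in unitmx /\
   [/\ in_algebra s H alg DA,
       (\rank DA <= p)%N,
       (A + DA) *m Xc = Xc *m La,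
       (A + DA) *m Xf = Xf *m Lf
     & [/\ in_algebra s H alg (A + DA),
           invariant_subspace (A + DA) VXc,
           invariant_subspace (A + DA) VXf
         & complementary_subspaces VXc VXf]]).
Proof.
have uH := unitary_unitmx _ _ H_unitary.
have sign_e : eps1 * eps2 alg = 1 \/ eps1 * eps2 alg = -1.
  by case: heps1 => ->; case: (@eps2_sign R k alg) => ->;
    rewrite ?mulr1 ?mulrNN ?mul1r; auto.
have inS M := in_algebraP s n H eps1 alg M uH heps1 H_star.
have uX : hcat hp Xc Xf \in unitmx.
  by apply: hcat_unitmx; rewrite Xc_span Xf_span; case: VXcf.
set e := eps1 * eps2 alg in hLa sign_e inS *.
have ee : e * e = 1 by case: sign_e => ->; rewrite ?mulrNN mulr1.
have e1e1 : eps1 * eps1 = 1 by case: heps1 => ->; rewrite ?mulrNN mulr1.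
have HA_star := (inS A).1 hA.
move GE: (star_mx s Xc *m H *m Xc) hLa => G hLa.
have Y0 : star_mx s Xc *m H *m Xf = 0.
  (* With [A^s H = eps2 H A]: [eps2 Lc^s Y = eps2 Xc^s A^s H Xf = Xc^s H A Xf = Y Lf]. *)
  apply: (spectrum_sylvester_eq0 _ _ _ _ _ hspec).
  rewrite -scalemxAl !mulmxA -star_mxM -Xc_eq star_mxM.
  rewrite -(mulmxA (star_mx s Xc)) -[in RHS](mulmxA _ Xf) -Xf_eq.
  have -> : star_mx s A *m H = eps2 alg *: (H *m A).
    have := HA_star; rewrite star_mxM H_star -scalemxAr -scalerA.
    by move/(congr1 ( *:%R eps1)); rewrite !scalerA e1e1 mul1r scale1r.
  rewrite -scalemxAr -scalemxAl scalerA.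
  have -> : eps2 alg * eps2 alg = 1 :> Kfield R k.
    by case: (@eps2_sign R k alg) => ->; rewrite ?mulrNN mulr1.
  by rewrite scale1r !mulmxA.
have uG : G \in unitmx.
  rewrite -row_free_unit -kermx_eq0; apply/eqP.
  (* The rows of [N] span the left kernel of [G]. Then [N Xc^s H] kills [Xc] and, by [Y0], also
     [Xf], so it is zero. Cancelling [H] and taking stars gives [Xc N^s = 0], and [Xc] has a left
     inverse. *)
  move: (kermx G) (mulmx_ker G) => N KG.
  have [W XW] : exists W, row_mx Xc Xf *m W = 1%:M.
    by apply: row_mx_right_inverse; rewrite Xc_span Xf_span; case: VXcf.
  have NX : N *m star_mx s Xc *m H = 0.
    rewrite -[LHS]mulmx1 -XW mulmxA mul_mx_row -!mulmxA.
    by rewrite !(mulmxA (star_mx s Xc)) Y0 GE KG mulmx0 row_mx0 mul0mx.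
  have sN0 : Xc *m star_mx s N = 0.
    rewrite -[Xc](star_mxK s) -star_mxM -[_ *m _](mulmxK uH) NX mul0mx.
    exact: star_mx0.
  have [Z ZXc] : exists Z, Z *m Xc = 1%:M.
    by apply/row_fullP; rewrite /row_full Xc_rank.
  by rewrite -[N](star_mxK s) -[star_mx s N]mul1mx -ZXc -mulmxA sN0 mulmx0 star_mx0.
have G_star : star_mx s G = eps1 *: G.
  by rewrite -GE !star_mxM star_mxK H_star -scalemxAl -scalemxAr !mulmxA.
(* [G Lc = Xc^s (H A) Xc] is a congruence of [H A] and inherits its symmetry. *)
have GLc_star : star_mx s (G *m Lc) = e *: (G *m Lc).
  rewrite -GE -mulmxA -Xc_eq !mulmxA -(mulmxA _ H) !star_mxM -star_mxM HA_star.
  by rewrite star_mxK -scalemxAl -scalemxAr !mulmxA.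
have GLa_star : star_mx s (G *m La) = e *: (G *m La).
  by rewrite [in RHS]hLa scalerA ee scale1r.
set D := Xc *m (La - Lc) *m invmx G *m star_mx s Xc *m H.
have D_alg : in_algebra s H alg D.
  apply/inS.
  (* With [P = G^-1 Xc^s H], this reads [H D = P^s G (La - Lc) P], as the two factors [eps1] in
     [P^s] cancel. The symmetry of [G La] and [G Lc] thus passes to [H D]. *)
  have -> : H *m D = star_mx s (invmx G *m star_mx s Xc *m H) *m
      (G *m (La - Lc)) *m (invmx G *m star_mx s Xc *m H).
    have G'_star : star_mx s (invmx G) = eps1 *: invmx G.
      rewrite star_invmx // G_star invmxZ -?G_star ?star_unitmx //.
      by case: heps1 => ->; rewrite ?invrN ?invr1.
    rewrite !star_mxM star_mxK G'_star H_star -!scalemxAr -!scalemxAl.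
    by rewrite scalerA e1e1 scale1r !mulmxA -(mulmxA _ (invmx G) G) mulVmx // mulmx1.
  rewrite -mulmxA star_mxM star_mxM star_mxK mulmxBr star_mxD star_mxN.
  by rewrite GLa_star GLc_star -scalerN -scalerDr -scalemxAr -scalemxAl !mulmxA.
have DXc : D *m Xc = Xc *m La - A *m Xc.
  by rewrite /D -!mulmxA (mulmxA (star_mx s Xc)) GE mulVmx // mulmx1 mulmxBr Xc_eq.
have DXf : D *m Xf = 0.
  by rewrite /D -!mulmxA (mulmxA (star_mx s Xc)) Y0 !mulmx0.
have ADXc : (A + D) *m Xc = Xc *m La by rewrite mulmxDl DXc addrC subrK.
have ADXf : (A + D) *m Xf = Xf *m Lf by rewrite mulmxDl DXf addr0.
have Vc_inv : invariant_subspace (A + D) VXc.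
  by rewrite -Xc_span; apply: colspace_invariant _ _ _ _ _ ADXc.
have Vf_inv : invariant_subspace (A + D) VXf.
  by rewrite -Xf_span; apply: colspace_invariant _ _ _ _ _ ADXf.
(* Part (ii) collects the facts on [D]; part (i) then follows by identifying its perturbation with
   [D]. *)
split=> /=; last first.
  split=> //; split=> //; last by split=> //; apply: in_algebraD.
  by rewrite /D -!mulmxA (leq_trans (mxrankM_maxl _ _)) ?Xc_rank.
set X := hcat hp Xc Xf in uX *; set B := hcat hp (Xc *m La - A *m Xc) 0.
have DX : D *m X = B by rewrite mul_hcat DXc DXf.
have -> : B *m invmx X + e *: (invmx H *m (star_mx s (H *m B *m invmx X)
    - star_mx s (invmx X) *m star_mx s (star_mx s X *m H *m B) *m invmx X)) = D.
  (* Since [(X^s H B)^s = (H B)^s X], the subtracted term is [X^-s (H B)^s X X^-1 = (H B X^-1)^s],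
     equal to the first. *)
  rewrite -(mulmxA _ H B) [star_mx s (star_mx s X *m _)]star_mxM star_mxK.
  rewrite mulmxA mulmxK // -star_mxM subrr mulmx0 scaler0 addr0.
  by rewrite -DX mulmxK.
split=> //.
by rewrite mul_mx_row ADXc ADXf mul_row_block !mulmx0 addr0 add0r.
Qed.
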